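(* Let $q_0,q_1\in\mathbb S^{2n+1}$. There exists a magnetic geodesic $\gamma$ with strength $s$ and contact angle $\psi$ connecting $q_0$ and $q_1$, more precisely such that $\gamma(-\tfrac T2)=q_0$ and $\gamma(\tfrac T2)=q_1$ for some $T\in\mathbb R$, if and only if (for this $T$) \[ \langle q_0,q_1\rangle=e^{-\mathrm i\frac s2T}\Big(\cos\big(|C_s(\psi)|T\big)+\mathrm i\cos\big(\mathrm{Arg}(C_s(\psi))\big)\sin\big(|C_s(\psi)|T\big)\Big). \]
   Context: $\mathbb S^{2n+1}$ is the unit sphere in $\mathbb C^{n+1}$ with standard Hermitian product $\langle z,w\rangle=\sum_jz_j\overline{w_j}$; $g=\mathrm{Re}\langle\cdot,\cdot\rangle$; $\alpha_z=\tfrac12\mathrm{Re}\langle\mathrm iz,\cdot\rangle$. For a closed two-form $\sigma$ the Lorentz force $Y$ is given by $g(Yu,v)=\sigma(u,v)$, and magnetic geodesics of $(\mathbb S^{2n+1},g,\sigma)$ are curves with $\nabla_{\dot\gamma}\dot\gamma=Y_\gamma\dot\gamma$ ($\nabla$ the Levi-Civita connection). A magnetic geodesic of strength $s\ge0$ is a unit speed magnetic geodesic $\gamma:\mathbb R\to\mathbb S^{2n+1}$ of $(\mathbb S^{2n+1},g,s\,\mathrm d\alpha)$. Its contact angle is the (constant) $\psi\in[0,\pi]$ with $\cos\psi=g_\gamma(\mathrm i\gamma,\dot\gamma)$. For $s\ge0$ and $\psi\in[0,\pi]$, $C_s(\psi):=(-\tfrac s2+\cos\psi,\sin\psi)\in\mathbb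 R^2$; $|C_s(\psi)|$ is its Euclidean norm and $\mathrm{Arg}(C_s(\psi))\in[0,\pi]$ its angle from the positive $x$-axis as seen from the origin, with the convention $\mathrm{Arg}(C_2(0))=\tfrac\pi2$.
   Formalization: The plus sign before i cos(Arg(C_s(ψ))) sin(|C_s(ψ)|T) is corrected to minus (the plus fails for γ(t)=e^{it}q, s=1, ψ=0, T=π), and n ≥ 1 is assumed (on the circle, ψ=π/2, T=0, q_0=q_1 satisfies the formula but no such geodesic exists). *)

(* Defs.v *)
From mathcomp Require Import all_boot all_order all_algebra.
From mathcomp Require Import all_classical all_reals all_analysis.
From mathcomp.real_closed Require Import complex.

Set Implicit Arguments.
Unset Strict Implicit.
Unset Printing Implicit Defensive.

Import Order.TTheory GRing.Theory Num.Theory.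
Import numFieldNormedType.Exports.

Local Open Scope ring_scope.


Section HermitianSpace.
Context {R : realType} {m : nat}.
Implicit Types z w u v : 'rV[R[i]]_m.

Definition hdot z w : R[i] := \sum_(j < m) z 0 j * (w 0 j)^*%C.

Definition gdot z w : R := complex.Re (hdot z w).

Definition hnorm z : R := Num.sqrt (gdot z z).

Definition imul z : 'rV[R[i]]_m := 'i%C *: z.

Definition on_sphere z : Prop := hnorm z = 1.

Definition tangent z v : Prop := gdot z v = 0.

(* Orthogonal projection onto the tangent space of the sphere at z. *)
Definition tproj z w : 'rV[R[i]]_m := w - (gdot w z)%:C%C *: z.

End HermitianSpace.

Section Forms.
Context {R : realType} {m : nat}.
Implicit Types z u v : 'rV[R[i]]_m.

Definition one_form : Type := 'rV[R[i]]_m -> 'rV[R[i]]_m -> R.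
Definition two_form : Type :=
  'rV[R[i]]_m -> 'rV[R[i]]_m -> 'rV[R[i]]_m -> R.

Definition alpha : one_form := fun z v => 2^-1 * gdot (imul z) v.

Definition dirderiv (f : 'rV[R[i]]_m -> R) z u : R :=
  (fun h : R => f (z + h%:C%C *: u))^`()%classic 0.

(* Exterior derivative, computed with the constant extensions of u and v (so
   that the bracket term vanishes).  As d commutes with pull-back, its
   restriction to tangent vectors of the sphere is the exterior derivative of
   the restricted one-form. *)
Definition extd (a : one_form) : two_form := fun z u v =>
  dirderiv (fun x => a x v) z u - dirderiv (fun x => a x u) z v.

Definition scale_form (s : R) (sigma : two_form) : two_form :=
  fun z u v => s * sigma z u v.

(* y = Y_z u, where Y is the Lorentz force of sigma on the sphere; y is
   determined by this, since g is nondegenerate on the tangent space. *)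
Definition is_lorentz_force (sigma : two_form) z u (y : 'rV[R[i]]_m) : Prop :=
  tangent z y /\ forall v, tangent z v -> gdot y v = sigma z u v.

End Forms.

Section Curves.
Context {R : realType} {m : nat}.
Implicit Types c X : R -> 'rV[R[i]]_m.

Definition smooth_curve c : Prop :=
  forall (j : 'I_m) (k : nat) (t : R),
    derivable (derive1n k (fun r => complex.Re (c r 0 j))) t 1 /\
    derivable (derive1n k (fun r => complex.Im (c r 0 j))) t 1.

Definition cderiv c : R -> 'rV[R[i]]_m := fun t =>
  \row_j @Complex R ((fun r => complex.Re (c r 0 j))^`()%classic t)
                    ((fun r => complex.Im (c r 0 j))^`()%classic t).

(* Levi-Civita covariant derivative along the curve c of a tangent field X:
   for a submanifold of a Euclidean space with the induced metric, it is the
   tangential part of the ambient derivative. *)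
Definition covderiv c X : R -> 'rV[R[i]]_m :=
  fun t => tproj (c t) (cderiv X t).

Definition magnetic_geodesic (sigma : @two_form R m) c : Prop :=
  [/\ smooth_curve c,
      forall t, on_sphere (c t) &
      forall t, is_lorentz_force sigma (c t) (cderiv c t)
                  (covderiv c (cderiv c) t)].

Definition magnetic_geodesic_of_strength (s : R) c : Prop :=
  magnetic_geodesic (scale_form s (extd alpha)) c /\
  forall t, hnorm (cderiv c t) = 1.

Definition has_contact_angle (psi : R) c : Prop :=
  0 <= psi <= pi /\
  forall t, cos psi = gdot (imul (c t)) (cderiv c t).

End Curves.

Section PlaneVector.
Context {R : realType}.

Definition norm2 (p : R * R) : R := Num.sqrt (p.1 ^+ 2 + p.2 ^+ 2).

(* Angle in [0, pi] of a vector of the closed upper half-plane.  The only zero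
   vector of the form Cvec s psi, with s >= 0 and psi in [0, pi], is Cvec 2 0,
   so the first case is the convention Arg (Cvec 2 0) = pi / 2. *)
Definition Arg (p : R * R) : R :=
  if p == (0, 0) then pi / 2 else acos (p.1 / norm2 p).

Definition Cvec (s psi : R) : R * R := (- (s / 2) + cos psi, sin psi).

(* exp (i theta) *)
Definition expi (theta : R) : R[i] := (cos theta +i* sin theta)%C.

End PlaneVector.

(* Main.v *)
Require Import Defs.
From mathcomp Require Import all_boot all_order all_algebra.
From mathcomp Require Import all_classical all_reals all_analysis.
From mathcomp.real_closed Require Import complex.
From mathcomp Require Import ring lra.
Import Order.TTheory GRing.Theory Num.Theory.
Import numFieldNormedType.Exports.
Local Open Scope ring_scope.

Set Implicit Arguments.
Unset Strict Implicit.
Unset Printing Implicit Defensive.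

(** The magnetic geodesic equation on the sphere is a linear equation in the
    ambient space.  Indeed [d alpha] is [g (i u, v)], so the acceleration of a
    magnetic geodesic [c] of strength [s] differs from [s i c'] by a normal
    vector, and the unit sphere, unit speed and contact angle conditions
    determine this vector: [c'' = i s c' + (s cos psi - 1) c]
    ([geodesic_equation]).  Put [r = |C_s(psi)|] and [k = cos (Arg C_s(psi))].
    Then [r^2 = (s / 2)^2 - s cos psi + 1] and [r k = cos psi - s / 2], so the
    curve [expi (- s t / 2) c] solves [X'' = - r^2 X].

    Necessity: taking the product with [c (- T / 2)] gives a complex-valued
    oscillator of frequency [r] with known initial data, because
    [hdot c c' = - i cos psi].  An energy argument identifies it
    ([hdot_geodesic]), and its value at [T / 2] is the asserted formula.

    Sufficiency: the formula says that the unit vectors [a = q0] and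
    [b = expi (- s T / 2) q1] satisfy [hdot a b = cos (r T) - i k sin (r T)].
    Then [b = cos (r T) a + sin (r T) u] for a unit vector [u] with
    [hdot a u = - i k] ([unit_circle_through]).  The great circle through [a] in
    the direction [u], run with angular velocity [r] and multiplied by
    [expi (s t / 2)], is a sum of two orthogonal uniform rotations with
    frequencies [s / 2 + r] and [s / 2 - r]; such a helix satisfies all the
    conditions ([helix_geodesic], [geodesic_great_circle]).

    In both directions the initial velocity of the oscillator is written as [r]
    times another quantity, with [r] allowed to be zero, so the degenerate case
    [C_s(psi) = 0] is not separated. *)

(** * Complex numbers *)

Section ComplexNumbers.
Context {R : realType}.
Implicit Types (x y : R) (a b : R[i]).

Lemma complex_ext a b :
  complex.Re a = complex.Re b -> complex.Im a = complex.Im b -> a = b.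
Proof. by case: a b => [? ?] [? ?] /= -> ->. Qed.

Lemma mulii : 'i%C * 'i%C = -1 :> R[i].
Proof. by rewrite -expr2 sqr_i. Qed.

Lemma conj_iM x : ('i%C * x%:C%C)^*%C = - ('i%C * x%:C%C) :> R[i].
Proof. by apply: complex_ext => /=; ring. Qed.

Lemma ReD a b : complex.Re (a + b) = complex.Re a + complex.Re b.
Proof. exact: raddfD. Qed.

Lemma ImD a b : complex.Im (a + b) = complex.Im a + complex.Im b.
Proof. exact: raddfD. Qed.

Lemma ReM a b :
  complex.Re (a * b)
  = complex.Re a * complex.Re b - complex.Im a * complex.Im b.
Proof. by case: a b => [? ?] []. Qed.

Lemma ImM a b :
  complex.Im (a * b)
  = complex.Re a * complex.Im b + complex.Im a * complex.Re b.
Proof. by case: a b => [? ?] []. Qed.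

Lemma Re_realM x a : complex.Re (x%:C%C * a) = x * complex.Re a.
Proof. by rewrite ReM /= mul0r subr0. Qed.

Lemma Im_realM x a : complex.Im (x%:C%C * a) = x * complex.Im a.
Proof. by rewrite ImM /= mul0r addr0. Qed.

Lemma expiD x y : expi (x + y) = expi x * expi y :> R[i].
Proof. by rewrite /expi sinD cosD; congr Complex; rewrite addrC. Qed.

Lemma expi0 : expi 0 = 1 :> R[i].
Proof. by rewrite /expi cos0 sin0. Qed.

Lemma conj_expi x : (expi x)^*%C = expi (- x) :> R[i].
Proof. by rewrite /expi cosN sinN. Qed.

Lemma expiNK x : expi (- x) * expi x = 1 :> R[i].
Proof. by rewrite -expiD addNr expi0. Qed.

Lemma expiE x : expi x = (cos x)%:C%C + 'i%C * (sin x)%:C%C :> R[i].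
Proof. by apply: complex_ext => /=; ring. Qed.

End ComplexNumbers.

(** * The Hermitian product *)

Section HermitianAlgebra.
Context {R : realType} {m : nat}.
Implicit Types (z w u v : 'rV[R[i]]_m) (a : R[i]) (x : R).

Lemma hdotDl z w v : hdot (z + w) v = hdot z v + hdot w v.
Proof. by rewrite -big_split; apply: eq_bigr => j _; rewrite mxE mulrDl. Qed.

Lemma hdotZl a z w : hdot (a *: z) w = a * hdot z w.
Proof. by rewrite mulr_sumr; apply: eq_bigr => j _; rewrite mxE mulrA. Qed.

Lemma hdotC z w : hdot w z = (hdot z w)^*%C.
Proof.
rewrite /hdot rmorph_sum; apply: eq_bigr => j _.
by rewrite rmorphM /= conjcK mulrC.
Qed.

Lemma hdotDr z w v : hdot z (w + v) = hdot z w + hdot z v.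
Proof. by rewrite hdotC hdotDl rmorphD /= -!hdotC. Qed.

Lemma hdotZr a z w : hdot z (a *: w) = a^*%C * hdot z w.
Proof. by rewrite hdotC hdotZl rmorphM /= -hdotC. Qed.

Lemma hdot_gdot z : hdot z z = (gdot z z)%:C%C.
Proof.
have: hdot z z = (hdot z z)^*%C := hdotC z z.
rewrite /gdot; case: (hdot z z) => x y [] /eqP.
by rewrite -subr_eq0 opprK -mulr2n mulrn_eq0 /= => /eqP ->.
Qed.

Lemma gdot_ge0 z : 0 <= gdot z z.
Proof.
rewrite -lecR -hdot_gdot; apply: sumr_ge0 => j _.
by rewrite mul_conjC_ge0.
Qed.

Lemma hdot_eq0 z : hdot z z = 0 -> z = 0.
Proof.
move/psumr_eq0P => z0; apply/rowP => j; rewrite mxE.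
apply/eqP; rewrite -mul_conjC_eq0; apply/eqP; apply: z0 => // l _.
exact: mul_conjC_ge0.
Qed.

Lemma hnorm1P z : hnorm z = 1 <-> hdot z z = 1.
Proof.
rewrite hdot_gdot /hnorm; split => [h|[h]].
  by rewrite -[gdot z z]sqr_sqrtr ?gdot_ge0// h expr1n.
by rewrite h sqrtr1.
Qed.

Lemma gdotDl z w v : gdot (z + w) v = gdot z v + gdot w v.
Proof. by rewrite /gdot hdotDl raddfD. Qed.

Lemma gdotZl x z w : gdot (x%:C%C *: z) w = x * gdot z w.
Proof. by rewrite /gdot hdotZl Re_realM. Qed.

Lemma gdotC z w : gdot w z = gdot z w.
Proof. by rewrite /gdot hdotC; case: (hdot z w). Qed.

Lemma gdot_imul z w : gdot (imul z) w = - gdot z (imul w).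
Proof.
rewrite /gdot hdotZl hdotZr; case: (hdot z w) => p q /=; ring.
Qed.

Lemma hdotE z w :
  hdot z w = (gdot z w +i* gdot (imul w) z)%C.
Proof.
rewrite /gdot hdotZl [hdot w z]hdotC; case: (hdot z w) => p q /=.
by congr Complex; ring.
Qed.

Lemma gdot_tproj z w v : gdot (tproj z w) v = gdot w v - gdot w z * gdot z v.
Proof. by rewrite /tproj gdotDl -scaleNr -rmorphN gdotZl mulNr. Qed.

End HermitianAlgebra.

(** * Derivatives of complex-valued functions of a real variable *)

Section ComplexDerivative.
Context {R : realType}.
Implicit Types (f g : R -> R[i]) (t : R) (a b : R[i]).

(** A derivative at a point is a pair of real derivatives, because
    smoothness and velocity of curves are read off real and imaginary parts of coordinates. *)
Definition has_cderiv f t a : Prop :=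
  is_derive t 1 (fun r => complex.Re (f r)) (complex.Re a) /\
  is_derive t 1 (fun r => complex.Im (f r)) (complex.Im a).

Lemma has_cderiv_uniq f t a b : has_cderiv f t a -> has_cderiv f t b -> a = b.
Proof.
move=> [f1 f2] [g1 g2]; apply/eqP; rewrite eq_complex.
rewrite -(@derive_val _ _ _ _ _ _ _ f1) -(@derive_val _ _ _ _ _ _ _ f2).
by rewrite !derive_val !eqxx.
Qed.

Lemma has_cderiv_cst a t : has_cderiv (fun=> a) t 0.
Proof. by split; exact: is_derive_cst. Qed.

Lemma has_cderivD f g t a b :
  has_cderiv f t a -> has_cderiv g t b ->
  has_cderiv (fun r => f r + g r) t (a + b).
Proof.
move=> [f1 f2] [g1 g2]; split; [rewrite ReD|rewrite ImD].
  under eq_fun do rewrite ReD.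
  exact: is_deriveD.
under eq_fun do rewrite ImD.
exact: is_deriveD.
Qed.

Lemma has_cderivM f g t a b :
  has_cderiv f t a -> has_cderiv g t b ->
  has_cderiv (fun r => f r * g r) t (a * g t + f t * b).
Proof.
move=> [f1 f2] [g1 g2]; split.
  rewrite (_ : (fun r => _) =
      (fun r => complex.Re (f r)) * (fun r => complex.Re (g r))
    - (fun r => complex.Im (f r)) * (fun r => complex.Im (g r))); last first.
    by apply/funext => r; rewrite ReM.
  by apply: is_derive_eq; rewrite ReD !ReM /GRing.scale /=; ring.
rewrite (_ : (fun r => _) =
      (fun r => complex.Re (f r)) * (fun r => complex.Im (g r))
    + (fun r => complex.Im (f r)) * (fun r => complex.Re (g r))); last first.
  by apply/funext => r; rewrite ImM.
by apply: is_derive_eq; rewrite ImD !ImM /GRing.scale /=; ring.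
Qed.

Lemma has_cderiv_conj f t a :
  has_cderiv f t a -> has_cderiv (fun r => (f r)^*%C) t a^*%C.
Proof.
move=> [f1 f2]; split.
  rewrite (_ : (fun r => _) = (fun r => complex.Re (f r))); last first.
    by apply/funext => r; rewrite /conjc; case: (f r).
  by case: a f1 f2.
rewrite (_ : (fun r => _) = - (fun r => complex.Im (f r))); last first.
  by apply/funext => r; rewrite fctE /conjc; case: (f r).
by rewrite (_ : complex.Im _ = - complex.Im a);
  [exact: is_deriveN | case: a {f1 f2}].
Qed.

Lemma has_cderiv_sum n (f : 'I_n -> R -> R[i]) t (a : 'I_n -> R[i]) :
  (forall j, has_cderiv (f j) t (a j)) ->
  has_cderiv (fun r => \sum_(j < n) f j r) t (\sum_(j < n) a j).
Proof.
elim: n f a => [|n IH] f a fa.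
  rewrite big_ord0 (_ : (fun r => _) = fun=> 0); first exact: has_cderiv_cst.
  by apply/funext => r; rewrite big_ord0.
rewrite big_ord_recr (_ : (fun r => _) =
  fun r => \sum_(j < n) f (widen_ord (leqnSn n) j) r + f ord_max r).
  by apply: has_cderivD; [apply: IH => j|]; exact: fa.
by apply/funext => r; rewrite big_ord_recr.
Qed.

Lemma has_cderiv_expi (x t : R) :
  has_cderiv (fun r => expi (x * r)) t ('i%C * x%:C%C * expi (x * t)).
Proof.
have dx : is_derive t 1 ( *%R x) x.
  by apply: is_derive_eq; rewrite /GRing.scale /= mulr1.
split => /=.
  apply: (@is_derive_eq _ _ _ (cos \o ( *%R x))).
  by rewrite /GRing.scale /=; ring.
apply: (@is_derive_eq _ _ _ (sin \o ( *%R x))).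
by rewrite /GRing.scale /=; ring.
Qed.

End ComplexDerivative.

(** * Derivatives of curves, and helices *)

Section CurveDerivatives.
Context {R : realType} {m : nat}.
Implicit Types (c d : R -> 'rV[R[i]]_m) (t : R) (v w P Q : 'rV[R[i]]_m).

Definition has_vderiv c t v : Prop :=
  forall j, has_cderiv (fun r => c r 0 j) t (v 0 j).

Lemma has_vderiv_cst v t : has_vderiv (fun=> v) t 0.
Proof. by move=> j; rewrite mxE; exact: has_cderiv_cst. Qed.

Lemma has_vderivE c t v : has_vderiv c t v -> cderiv c t = v.
Proof.
move=> cv; apply/rowP => j; rewrite mxE; have [cre cim] := cv j.
by rewrite !derive1E !derive_val; case: (v 0 j).
Qed.

Lemma smooth_curve_vderiv c t :
  smooth_curve c -> has_vderiv c t (cderiv c t).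
Proof.
move=> sc j; have [cre cim] := sc j 0 t.
by rewrite mxE; split => /=; rewrite derive1E; exact: derivableP.
Qed.

Lemma Re_cderiv c j : (fun r => complex.Re (cderiv c r 0 j))
  = (fun r => complex.Re (c r 0 j))^`()%classic.
Proof. by apply/funext => r; rewrite mxE. Qed.

Lemma Im_cderiv c j : (fun r => complex.Im (cderiv c r 0 j))
  = (fun r => complex.Im (c r 0 j))^`()%classic.
Proof. by apply/funext => r; rewrite mxE. Qed.

Lemma smooth_curve_cderiv c : smooth_curve c -> smooth_curve (cderiv c).
Proof.
move=> sc j k t; have := sc j k.+1 t.
rewrite /derive1n !iterSr.
by rewrite -Re_cderiv -Im_cderiv.
Qed.

Lemma has_cderiv_hdot c d t v w :
  has_vderiv c t v -> has_vderiv d t w ->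
  has_cderiv (fun r => hdot (c r) (d r)) t (hdot v (d t) + hdot (c t) w).
Proof.
move=> cv dw; rewrite /hdot -big_split; apply: has_cderiv_sum => j.
by apply: has_cderivM; [|apply: has_cderiv_conj]; [exact: cv|exact: dw].
Qed.

(** A superposition of two uniform rotations.  Magnetic geodesics of the sphere
    are of this form, with [P] and [Q] orthogonal; [i mu] and [i nu] are the
    characteristic roots of their equation. *)
Definition helix (mu nu : R) P Q : R -> 'rV[R[i]]_m :=
  fun t => expi (mu * t) *: P + expi (nu * t) *: Q.

Lemma has_vderiv_helix mu nu P Q t :
  has_vderiv (helix mu nu P Q) t
    (helix mu nu (('i%C * mu%:C%C) *: P) (('i%C * nu%:C%C) *: Q) t).
Proof.
move=> j; rewrite /helix; under eq_fun do rewrite !mxE.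
rewrite !mxE; apply: has_cderivD.
  have := has_cderivM (has_cderiv_expi mu t) (has_cderiv_cst (P 0 j) t).
  by rewrite mulr0 addr0 -mulrA mulrCA.
have := has_cderivM (has_cderiv_expi nu t) (has_cderiv_cst (Q 0 j) t).
by rewrite mulr0 addr0 -mulrA mulrCA.
Qed.

Lemma cderiv_helix mu nu P Q :
  cderiv (helix mu nu P Q)
  = helix mu nu (('i%C * mu%:C%C) *: P) (('i%C * nu%:C%C) *: Q).
Proof. by apply/funext => t; apply/has_vderivE/has_vderiv_helix. Qed.

(** Differentiation maps helices to helices with the same frequencies, so the
    derivatives of all orders are covered by one induction for all [P] and [Q]
    at once. *)
Lemma smooth_helix mu nu P Q : smooth_curve (helix mu nu P Q).
Proof.
move=> j k; elim: k P Q => [|k IH] P Q t.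
  by have [dre dim] := has_vderiv_helix mu nu P Q t j; split; apply: ex_derive.
have := IH (('i%C * mu%:C%C) *: P) (('i%C * nu%:C%C) *: Q) t.
rewrite /derive1n !iterSr.
by rewrite -cderiv_helix Re_cderiv Im_cderiv.
Qed.

End CurveDerivatives.

(** * The Lorentz force on the sphere *)

Section LorentzForce.
Context {R : realType} {m : nat}.
Implicit Types (z u v w : 'rV[R[i]]_m) (s : R).

(** [alpha] is linear in its base point. *)
Lemma dirderiv_alpha z u v :
  dirderiv (fun x => alpha x v) z u = 2^-1 * gdot (imul u) v.
Proof.
rewrite /dirderiv /alpha (_ : (fun h => _) =
  cst (2^-1 * gdot (imul z) v) + (2^-1 * gdot (imul u) v) \*: id); last first.
  apply/funext => h.
  rewrite -[RHS]/(2^-1 * gdot (imul z) v + 2^-1 * gdot (imul u) v * h).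
  rewrite (_ : imul _ = imul z + h%:C%C *: imul u); last first.
    by rewrite /imul scalerDr !scalerA mulrC.
  by rewrite gdotDl gdotZl; ring.
by rewrite derive1E derive_val /GRing.scale /=; ring.
Qed.

Lemma extd_alpha z u v : extd alpha z u v = gdot (imul u) v.
Proof.
rewrite /extd !dirderiv_alpha [gdot (imul v) u]gdot_imul [gdot v _]gdotC.
by field.
Qed.

Lemma tproj_tangent z w : on_sphere z -> tangent z (tproj z w).
Proof.
move=> /hnorm1P; rewrite hdot_gdot => -[z1].
by rewrite /tangent gdotC gdot_tproj z1 mulr1 subrr.
Qed.

(** On tangent vectors, [d alpha] is [g (i u, v)]; nondegeneracy of [g] on the
    tangent space turns the implicit definition of the force into an equation
    between vectors.  For [u] the velocity and [w] the ambient acceleration of a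
    curve, it says that the acceleration minus [s] times [i u] is normal. *)
Lemma lorentz_forceP s z u w : on_sphere z ->
  is_lorentz_force (scale_form s (extd alpha)) z u (tproj z w) <->
  tproj z (w - s%:C%C *: imul u) = 0.
Proof.
move=> z1; set x := tproj _ (_ - _).
have xE v : tangent z v -> gdot x v = gdot (tproj z w) v - s * gdot (imul u) v.
  move=> zv; rewrite !gdot_tproj zv !mulr0 !subr0.
  by rewrite gdotDl -scaleNr -rmorphN gdotZl mulNr.
split=> [[_ force]|x0].
  have zx : tangent z x by exact: tproj_tangent.
  apply: hdot_eq0.
  by rewrite hdot_gdot xE// force// /scale_form extd_alpha subrr.
split=> [|v zv]; first exact: tproj_tangent.
rewrite /scale_form extd_alpha; apply/eqP; rewrite -subr_eq0 -xE// x0.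
by rewrite -(scale0r z) -(rmorph0 (real_complex R)) gdotZl mul0r.
Qed.

End LorentzForce.

(** * The harmonic oscillator *)

Section Oscillator.
Context {R : realType}.
Implicit Types (c a b t : R).

(** The energy [f'^2 + c^2 f^2] is conserved, hence zero.  Therefore [f']
    vanishes and [f] is constant: the conclusion holds for [c = 0] as well. *)
Lemma oscillator_eq0 c a (f f1 : R -> R) :
  (forall t, is_derive t 1 f (f1 t)) ->
  (forall t, is_derive t 1 f1 (- c ^+ 2 * f t)) ->
  f a = 0 -> f1 a = 0 -> forall t, f t = 0.
Proof.
move=> df df1 fa f1a t; rewrite -fa; apply: is_derive_0_is_cst => {}t.
have energy : f1 t ^+ 2 + c ^+ 2 * f t ^+ 2 = 0.
  transitivity (f1 a ^+ 2 + c ^+ 2 * f a ^+ 2); last by rewrite fa f1a; ring.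
  apply: (@is_derive_0_is_cst _ (f1 ^+ 2 + (c ^+ 2) \*: (f ^+ 2))) => r.
  by apply: is_derive_eq; rewrite /GRing.scale /=; ring.
have /eqP : f1 t ^+ 2 = 0.
  by apply/eqP; rewrite eq_le sqr_ge0 andbT -energy lerDl mulr_ge0 ?sqr_ge0.
by rewrite sqrf_eq0 => /eqP <-.
Qed.

(** Writing the initial velocity as [c * b] instead of dividing by [c] keeps the
    formula valid in the degenerate case [c = 0]. *)
Lemma oscillatorE c a b (f f1 : R -> R) :
  (forall t, is_derive t 1 f (f1 t)) ->
  (forall t, is_derive t 1 f1 (- c ^+ 2 * f t)) ->
  f1 a = c * b ->
  forall t, f t = cos (c * (t - a)) * f a + sin (c * (t - a)) * b.
Proof.
move=> df df1 f1a t.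
pose C t := cos (c * (t - a)); pose S t := sin (c * (t - a)).
have Ca : C a = 1 by rewrite /C subrr mulr0 cos0.
have Sa : S a = 0 by rewrite /S subrr mulr0 sin0.
have daff (r : R) : is_derive r 1 (fun t : R => c * (t - a)) c.
  rewrite (_ : (fun t : R => _) = c \*: (id - cst a)) //.
  by apply: is_derive_eq; rewrite /GRing.scale /= subr0 mulr1.
have dC (r : R) : is_derive r 1 C (- c * S r).
  apply: (@is_derive_eq _ _ _ (cos \o (fun t : R => c * (t - a)))).
  by rewrite /GRing.scale /= /S; ring.
have dS (r : R) : is_derive r 1 S (c * C r).
  apply: (@is_derive_eq _ _ _ (sin \o (fun t : R => c * (t - a)))).
  by rewrite /GRing.scale /= /C; ring.
suff fE : f t - (f a * C t + b * S t) = 0.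
  by apply/eqP; rewrite -subr_eq0 -fE; apply/eqP; rewrite /C /S; ring.
apply: (@oscillator_eq0 c a (f - (f a \*: C + b \*: S))
          (f1 - (f a \*: (- c \*: S) + b \*: (c \*: C)))) => [r| |].
- by apply: is_derive_eq; rewrite !fctE /GRing.scale /= /GRing.scale /=; ring.
- by rewrite !fctE /GRing.scale /= /GRing.scale /= Ca Sa; ring.
- by rewrite !fctE /GRing.scale /= /GRing.scale /= f1a Ca Sa; ring.
Qed.

Lemma complex_oscillatorE c a (b : R[i]) (f f1 : R -> R[i]) :
  (forall t, has_cderiv f t (f1 t)) ->
  (forall t, has_cderiv f1 t (- (c ^+ 2)%:C%C * f t)) ->
  f1 a = c%:C%C * b ->
  forall t, f t = (cos (c * (t - a)))%:C%C * f a + (sin (c * (t - a)))%:C%C * b.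
Proof.
move=> df df1 f1a t; apply: complex_ext.
  rewrite ReD !Re_realM.
  apply: (@oscillatorE c a (complex.Re b) (fun r => complex.Re (f r))
            (fun r => complex.Re (f1 r))) => [r|r|].
  - by have [] := df r.
  - by have [+ _] := df1 r; rewrite -rmorphN Re_realM.
  - by rewrite f1a Re_realM.
rewrite ImD !Im_realM.
apply: (@oscillatorE c a (complex.Im b) (fun r => complex.Im (f r))
            (fun r => complex.Im (f1 r))) => [r|r|].
- by have [] := df r.
- by have [_ +] := df1 r; rewrite -rmorphN Im_realM.
- by rewrite f1a Im_realM.
Qed.

End Oscillator.

(** * Magnetic geodesics solve a linear equation *)

Section GeodesicEquation.
Context {R : realType} {m : nat} {s psi : R} {c : R -> 'rV[R[i]]_m}.
Hypothesis geo : magnetic_geodesic_of_strength s c.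
Hypothesis ang : has_contact_angle psi c.
Implicit Types t : R.

Let smooth_c : smooth_curve c. Proof. by case: geo => -[]. Qed.
Let sphere_c t : on_sphere (c t). Proof. by case: geo => -[]. Qed.
Let dc t : has_vderiv c t (cderiv c t).
Proof. exact: smooth_curve_vderiv. Qed.
Let ddc t : has_vderiv (cderiv c) t (cderiv (cderiv c) t).
Proof. exact/smooth_curve_vderiv/smooth_curve_cderiv. Qed.

(** Real part: the curve stays on the sphere.  Imaginary part: the contact
    angle. *)
Lemma geodesic_hdot_velocity t :
  hdot (c t) (cderiv c t) = - ('i%C * (cos psi)%:C%C).
Proof.
have cc1 r : hdot (c r) (c r) = 1 by apply/hnorm1P; exact: sphere_c.
have := has_cderiv_hdot (dc t) (dc t).
under eq_fun do rewrite cc1.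
move=> /has_cderiv_uniq/(_ (has_cderiv_cst 1 t))/(congr1 (@complex.Re R)).
rewrite ReD -/(gdot (cderiv c t) _) -/(gdot (c t) _) gdotC => cv.
have {cv} cv0 : gdot (c t) (cderiv c t) = 0 by move: cv => /=; lra.
rewrite hdotE cv0 gdot_imul gdotC -(ang.2 t).
by apply: complex_ext => /=; ring.
Qed.

(** The product of position and velocity is constant; differentiate it and use
    unit speed. *)
Lemma geodesic_hdot_acceleration t : hdot (c t) (cderiv (cderiv c) t) = - 1.
Proof.
have := has_cderiv_hdot (dc t) (ddc t).
under eq_fun do rewrite geodesic_hdot_velocity.
move=> /has_cderiv_uniq/(_ (has_cderiv_cst _ t)).
have /hnorm1P -> : hnorm (cderiv c t) = 1 by case: geo.
by move/eqP; rewrite addrC addr_eq0 => /eqP.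
Qed.

(** The acceleration minus [s i c'] is normal, hence a real multiple of [c], and
    the multiple is found by taking the product with [c]. *)
Lemma geodesic_equation t :
  cderiv (cderiv c) t =
  ('i%C * s%:C%C) *: cderiv c t + (s * cos psi - 1)%:C%C *: c t.
Proof.
have [[_ _ force] _] := geo.
have /eqP := (lorentz_forceP _ _ _ (sphere_c t)).1 (force t).
rewrite /tproj subr_eq0 subr_eq => /eqP ->.
rewrite gdotDl -scaleNr -rmorphN gdotZl gdot_imul [gdot _ (imul _)]gdotC.
rewrite -(ang.2 t) gdotC {1}/gdot geodesic_hdot_acceleration /= addrC.
rewrite /imul scalerA.
by rewrite [s%:C%C * _]mulrC; congr (_ + _%:C%C *: _); ring.
Qed.

(** The factor [expi (s / 2 * t)] removes the first order term of the equation
    solved by [hdot (c a) (c t)]; what is left is an oscillator of frequency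
    [r], whose initial velocity at [a] is [- i (cos psi - s / 2) = - i r k] times
    its initial value. *)
Lemma hdot_geodesic (r k : R) :
  r ^+ 2 = (s / 2) ^+ 2 - s * cos psi + 1 -> r * k = cos psi - s / 2 ->
  forall a t, hdot (c a) (c t) =
    expi (- (s / 2 * (t - a))) *
    ((cos (r * (t - a)))%:C%C - 'i%C * k%:C%C * (sin (r * (t - a)))%:C%C).
Proof.
move=> r2 rk a t.
pose h t := hdot (c a) (c t); pose h1 t := hdot (c a) (cderiv c t).
pose E t : R[i] := expi (s / 2 * t); pose w : R[i] := 'i%C * (s / 2)%:C%C.
have dE b : has_cderiv E b (w * E b) by exact: has_cderiv_expi.
have dh b : has_cderiv h b (h1 b).
  have := has_cderiv_hdot (has_vderiv_cst (c a) b) (dc b).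
  by rewrite -(scale0r 0) hdotZl mul0r add0r.
have dh1 b : has_cderiv h1 b (hdot (c a) (cderiv (cderiv c) b)).
  have := has_cderiv_hdot (has_vderiv_cst (c a) b) (ddc b).
  by rewrite -(scale0r 0) hdotZl mul0r add0r.
pose g b := E b * h b; pose g1 b := E b * (w * h b + h1 b).
have dg b : has_cderiv g b (g1 b).
  rewrite (_ : g1 b = w * E b * h b + E b * h1 b); last by rewrite /g1; ring.
  exact: has_cderivM.
have dg1 b : has_cderiv g1 b (- (r ^+ 2)%:C%C * g b).
  have := has_cderivM (dE b)
    (has_cderivD (has_cderivM (has_cderiv_cst w b) (dh b)) (dh1 b)).
  congr has_cderiv.
  rewrite geodesic_equation hdotDr !hdotZr -/(h b) -/(h1 b) conjc_real.
  rewrite (_ : ('i%C * s%:C%C)^*%C = - (w + w)); last first.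
    by rewrite conj_iM /w {1}(splitr s) rmorphD /=; ring.
  have w2 : w * w = - ((s / 2) ^+ 2)%:C%C.
    by rewrite /w mulrACA mulii -rmorphM -expr2 mulN1r.
  rewrite r2 /g (_ : (s * cos psi - 1)%:C%C
     = - ((s / 2) ^+ 2 - s * cos psi + 1)%:C%C - w * w); last first.
    by rewrite w2 -!rmorphN -rmorphD; congr (_%:C%C); ring.
  by ring.
have /hnorm1P haa := sphere_c a.
have g1a : g1 a = r%:C%C * (- ('i%C * k%:C%C) * E a).
  rewrite /g1 /h /h1 haa geodesic_hdot_velocity.
  rewrite (_ : r%:C%C * _ = - ('i%C * (r * k)%:C%C) * E a); last first.
    by rewrite rmorphM /=; ring.
  by rewrite rk /w rmorphB /=; ring.
have := complex_oscillatorE dg dg1 g1a t.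
rewrite /g {2}/h haa mulr1 => gt.
rewrite -[LHS]/(h t) -[LHS]mul1r -(expiNK (s / 2 * t)) -/(E t) -mulrA gt.
rewrite (_ : - (s / 2 * (t - a)) = - (s / 2 * t) + s / 2 * a); last by ring.
by rewrite expiD -/(E a); ring.
Qed.

End GeodesicEquation.

(** * Helices that are magnetic geodesics *)

Section HelixGeodesic.
Context {R : realType} {m : nat}.

Lemma hdot_helix (mu nu : R) (P Q P' Q' : 'rV[R[i]]_m) t :
  hdot P Q' = 0 -> hdot Q P' = 0 ->
  hdot (helix mu nu P Q t) (helix mu nu P' Q' t) = hdot P P' + hdot Q Q'.
Proof.
move=> PQ QP; rewrite /helix hdotDl !hdotDr !hdotZl !hdotZr PQ QP.
rewrite !mulr0 addr0 add0r.
by rewrite !conj_expi !mulrA ![expi (_ * t) * _]mulrC !expiNK !mul1r.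
Qed.

(** The frequencies are the roots of [X^2 - s X + (s cos psi - 1)], so the helix
    solves the geodesic equation.  As [X^2] is affine in [X] at the two roots, the
    squared speed [mu^2 |P|^2 + nu^2 |Q|^2] is a combination of the two
    normalizations, and equals 1. *)
Lemma helix_geodesic (s psi mu nu : R) (P Q : 'rV[R[i]]_m) :
  0 <= psi <= pi ->
  mu + nu = s -> mu * nu = s * cos psi - 1 ->
  hdot P Q = 0 -> gdot P P + gdot Q Q = 1 ->
  mu * gdot P P + nu * gdot Q Q = cos psi ->
  magnetic_geodesic_of_strength s (helix mu nu P Q) /\
  has_contact_angle psi (helix mu nu P Q).
Proof.
move=> psi_pi sumE prodE PQ norm1 angle.
have QP : hdot Q P = 0 by rewrite hdotC PQ conjc0.
set c := helix mu nu P Q.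
have sphere t : on_sphere (c t).
  by apply/hnorm1P; rewrite hdot_helix// !hdot_gdot -rmorphD norm1.
have velocity t : hdot (c t) (cderiv c t) = - ('i%C * (cos psi)%:C%C).
  rewrite cderiv_helix hdot_helix ?hdotZr ?PQ ?QP ?mulr0// !conj_iM !hdot_gdot.
  by rewrite -angle rmorphD !rmorphM /=; ring.
have speed t : hnorm (cderiv c t) = 1.
  apply/hnorm1P.
  rewrite cderiv_helix hdot_helix ?hdotZl ?hdotZr ?PQ ?QP ?mulr0//.
  have iM2 x : 'i%C * x%:C%C * (- ('i%C * x%:C%C)) = (x ^+ 2)%:C%C :> R[i].
    by rewrite mulrN mulrACA mulii mulN1r opprK -rmorphM -expr2.
  rewrite !conj_iM !hdot_gdot !mulrA !iM2 -!rmorphM -rmorphD.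
  rewrite (_ : _ + _ = (mu + nu) * (mu * gdot P P + nu * gdot Q Q)
                        - mu * nu * (gdot P P + gdot Q Q)); last by ring.
  by rewrite sumE prodE angle norm1 (_ : _ - _ = 1)//; ring.
have ode t : cderiv (cderiv c) t =
  ('i%C * s%:C%C) *: cderiv c t + (s * cos psi - 1)%:C%C *: c t.
  rewrite !cderiv_helix -prodE -sumE; apply/rowP => j; rewrite !mxE.
  rewrite (_ : (mu * nu)%:C%C
               = - ('i%C * 'i%C) * mu%:C%C * nu%:C%C); last first.
    by rewrite mulii opprK mul1r rmorphM.
  by rewrite rmorphD /=; ring.
split; last first.
  split=> // t; rewrite /gdot hdotZl velocity mulrN mulrA mulii.
  by rewrite mulN1r opprK.
split=> //; split=> // [|t]; first exact: smooth_helix.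
have /hnorm1P := sphere t; rewrite hdot_gdot => -[c1].
apply/lorentz_forceP => //; rewrite ode /imul scalerA [s%:C%C * _]mulrC.
rewrite addrAC subrr.
by rewrite add0r /tproj gdotZl c1 mulr1 subrr.
Qed.

(** A great circle traversed with angular velocity [r] and rotated by
    [expi (s / 2 * t)] is a helix with frequencies [s / 2 + r] and [s / 2 - r]:
    write [cos] and [sin] as exponentials. *)
Lemma geodesic_great_circle (s psi r k t0 : R) (a u : 'rV[R[i]]_m) :
  0 <= psi <= pi ->
  r ^+ 2 = (s / 2) ^+ 2 - s * cos psi + 1 -> r * k = cos psi - s / 2 ->
  hdot a a = 1 -> hdot u u = 1 -> hdot a u = - ('i%C * k%:C%C) ->
  exists gamma : R -> 'rV[R[i]]_m,
    [/\ magnetic_geodesic_of_strength s gamma, has_contact_angle psi gamma &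
     forall t, gamma t = expi (s / 2 * (t - t0)) *:
       ((cos (r * (t - t0)))%:C%C *: a + (sin (r * (t - t0)))%:C%C *: u)].
Proof.
move=> psi_pi r2 rk aa uu au.
(* The components of the helix are [(a - i u) / 2] and [(a + i u) / 2], each up
   to a phase that moves the starting time to [t0]; [e] is the sign. *)
pose X (e x : R) := expi x *: ((2^-1)%:C%C *: (a + ('i%C * e%:C%C) *: u)).
have ua : hdot u a = 'i%C * k%:C%C.
  by rewrite hdotC au -mulrN -rmorphN conj_iM rmorphN mulrN opprK.
have XX e f x y : hdot (X e x) (X f y) = expi (x - y) *
    ((1 - f * k - e * k + e * f) / 4)%:C%C.
  rewrite /X !hdotZl !hdotZr conj_expi conjc_real.
  rewrite hdotDl !hdotDr !hdotZl !hdotZr.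
  rewrite conj_iM aa uu au ua expiD.
  rewrite (_ : (_ / 4)%:C%C = (2^-1)%:C%C * (2^-1)%:C%C *
    (1 + 'i%C * 'i%C *
       (f%:C%C * k%:C%C + e%:C%C * k%:C%C - e%:C%C * f%:C%C))); last first.
    by apply: complex_ext => /=; field.
  by ring.
have gXX e x : gdot (X e x) (X e x) = (1 - e * k - e * k + e * e) / 4.
  by rewrite /gdot XX subrr expi0 mul1r.
pose mu := s / 2 + r; pose nu := s / 2 - r.
pose P := X (-1) (- (mu * t0)); pose Q := X 1 (- (nu * t0)).
have [] := @helix_geodesic s psi mu nu P Q psi_pi.
- by rewrite /mu /nu; field.
- by rewrite /mu /nu mulrC -subr_sqr r2; ring.
- by rewrite XX (_ : _ / 4 = 0) ?mulr0//; ring.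
- by rewrite !gXX; field.
- rewrite !gXX (_ : _ + _ = s / 2 + r * k); last by rewrite /mu /nu; field.
  by rewrite rk; ring.
move=> geo ang; exists (helix mu nu P Q); split=> // t.
rewrite /helix /P /Q /X !scalerA -!expiD.
rewrite (_ : mu * t + _ = s / 2 * (t - t0) + r * (t - t0));
  last by rewrite /mu; ring.
rewrite (_ : nu * t + _ = s / 2 * (t - t0) - r * (t - t0));
  last by rewrite /nu; ring.
set x := s / 2 * _; set y := r * _; set h := (2^-1)%:C%C.
have hh : h + h = 1.
  by apply: complex_ext => /=; field.
apply/rowP => j; rewrite !expiD (expiE y) (expiE (- y)) cosN sinN !mxE.
rewrite !(rmorphN (real_complex R)) rmorph1.
transitivity ((h + h) * (expi x * ((cos y)%:C%C * a 0 j
    - 'i%C * 'i%C * (sin y)%:C%C * u 0 j))); first by ring.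
by rewrite hh mulii; ring.
Qed.

End HelixGeodesic.

(** * Great circles through two unit vectors *)

Section GreatCircle.
Context {R : realType}.

Lemma orthogonal_unit_vector {m : nat} (a : 'rV[R[i]]_m) : (1 < m)%N ->
  exists2 e : 'rV[R[i]]_m, hdot e e = 1 & hdot a e = 0.
Proof.
move=> m1; pose A : 'M[R[i]]_(m, 1) := \matrix_(j, _) (a 0 j)^*%C.
have /rowV0Pn[v /sub_kermxP vA v0] : kermx A != 0.
  rewrite kermx_eq0 /row_free; apply: contraTneq m1 => <-.
  by rewrite -leqNgt rank_leq_col.
have va : hdot v a = 0.
  have := congr1 (fun M : 'M[R[i]]_1 => M 0 0) vA; rewrite !mxE => <-.
  by apply: eq_bigr => j _; rewrite mxE.
have g0 : 0 < gdot v v.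
  rewrite lt_neqAle gdot_ge0 andbT eq_sym; apply: contra_neq v0 => v0.
  by apply: hdot_eq0; rewrite hdot_gdot v0.
exists ((Num.sqrt (gdot v v))^-1%:C%C *: v).
  rewrite hdotZl hdotZr conjc_real hdot_gdot -!rmorphM /=.
  by rewrite mulrA -invfM -expr2 sqr_sqrtr ?ltW// mulVf ?gt_eqF.
by rewrite hdotZr [hdot a v]hdotC va conjc0 mulr0.
Qed.

(** If [sin theta <> 0], then [u] is determined by the last equation, and its
    norm and its product with [a] come out right.  Otherwise [b = a] or
    [b = - a], the last equation leaves [u] free, and a vector orthogonal to
    [a] is needed to reach norm 1: this is where the dimension enters. *)
Lemma unit_circle_through {m : nat} (a b : 'rV[R[i]]_m) (theta k : R) :
  (1 < m)%N -> hdot a a = 1 -> hdot b b = 1 -> -1 <= k <= 1 ->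
  hdot a b = (cos theta)%:C%C - 'i%C * k%:C%C * (sin theta)%:C%C ->
  exists u, [/\ hdot u u = 1, hdot a u = - ('i%C * k%:C%C) &
    b = (cos theta)%:C%C *: a + (sin theta)%:C%C *: u].
Proof.
move=> m1 aa bb k1 ab.
have ba : hdot b a = (cos theta)%:C%C + 'i%C * k%:C%C * (sin theta)%:C%C.
  rewrite hdotC ab; apply: complex_ext => /=; ring.
pose d := b - (cos theta)%:C%C *: a.
have dd : hdot d d = (sin theta ^+ 2)%:C%C.
  rewrite /d -scaleNr -rmorphN hdotDl !hdotDr !hdotZl !hdotZr conjc_real.
  rewrite aa bb ab ba.
  by rewrite sin2cos2 rmorphB /= rmorph1 rmorphXn rmorphN /=; ring.
have ad : hdot a d = - ('i%C * k%:C%C) * (sin theta)%:C%C.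
  rewrite /d -scaleNr -rmorphN hdotDr hdotZr conjc_real aa ab rmorphN /=.
  by ring.
have bE : b = (cos theta)%:C%C *: a + d by rewrite addrC subrK.
have [s0|s0] := eqVneq (sin theta) 0.
  have [e ee ae] := orthogonal_unit_vector a m1.
  have ea : hdot e a = 0 by rewrite hdotC ae conjc0.
  exists (('i%C * k%:C%C) *: a + (Num.sqrt (1 - k ^+ 2))%:C%C *: e).
  have d0 : d = 0 by apply: hdot_eq0; rewrite dd s0 expr0n.
  split; last by rewrite s0 scale0r {1}bE d0.
    rewrite hdotDl !hdotDr !hdotZl !hdotZr conjc_real conj_iM aa ee ae ea.
    have k2 : 0 <= 1 - k ^+ 2 by case/andP: k1 => ? ?; nra.
    have qq : (Num.sqrt (1 - k ^+ 2))%:C%C * (Num.sqrt (1 - k ^+ 2))%:C%C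
              = 1 - k%:C%C * k%:C%C :> R[i].
      by rewrite -rmorphM -expr2 sqr_sqrtr// rmorphB rmorph1 rmorphXn.
    rewrite !mulr0 addr0 add0r !mulr1 qq mulrN mulrACA mulii; ring.
  by rewrite hdotDr !hdotZr conj_iM aa ae mulr0 mulr1 addr0.
have sC0 : (sin theta)%:C%C != 0 :> R[i].
  by rewrite (fmorph_eq0 (real_complex R)).
exists ((sin theta)^-1%:C%C *: d); split.
- by rewrite hdotZl hdotZr conjc_real dd -!rmorphM /=; congr (_%:C%C); field.
- by rewrite hdotZr conjc_real ad fmorphV /=; field.
- by rewrite scalerA -rmorphM /= mulfV// scale1r -bE.
Qed.

End GreatCircle.

(** * Polar coordinates of a vector of the upper half-plane *)

Section PlaneVector.
Context {R : realType}.
Implicit Types p : R * R.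

Lemma sqr_norm2 p : norm2 p ^+ 2 = p.1 ^+ 2 + p.2 ^+ 2.
Proof. by rewrite sqr_sqrtr// addr_ge0// sqr_ge0. Qed.

(** For the zero vector both sides vanish, whatever its angle. *)
Lemma norm2_cos_Arg p : norm2 p * cos (Arg p) = p.1.
Proof.
rewrite /Arg; have [->|p0] := eqVneq p (0, 0).
  by rewrite cos_pihalf mulr0.
have np : norm2 p != 0.
  apply: contra_neq p0 => np0; have /eqP := sqr_norm2 p.
  rewrite np0 expr0n eq_sym paddr_eq0 ?sqr_ge0// !sqrf_eq0.
  by case: p {np0} => x y /= /andP[/eqP -> /eqP ->].
have np_gt0 : 0 < norm2 p by rewrite lt_neqAle eq_sym np sqrtr_ge0.
rewrite acosK; first by rewrite mulrCA mulfV// mulr1.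
rewrite in_itv /= -ler_norml normrM normfV [`|norm2 p|]gtr0_norm//.
rewrite ler_pdivrMr// mul1r -ler_sqr ?nnegrE ?normr_ge0 ?(ltW np_gt0)//.
by rewrite real_normK ?num_real// sqr_norm2 lerDl sqr_ge0.
Qed.

End PlaneVector.

(** * The connection problem *)

Theorem corollary1p10 (R : realType) (n : nat) (hn : (0 < n)%N)
    (s psi : R) (hs : 0 <= s) (hpsi : 0 <= psi <= pi)
    (q0 q1 : 'rV[R[i]]_n.+1) (hq0 : on_sphere q0) (hq1 : on_sphere q1)
    (T : R) :
  (exists gamma : R -> 'rV[R[i]]_n.+1,
     [/\ magnetic_geodesic_of_strength s gamma,
         has_contact_angle psi gamma,
         gamma (- (T / 2)) = q0 &
         gamma (T / 2) = q1])
  <->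
  hdot q0 q1 =
    expi (- (s / 2 * T)) *
    ((cos (norm2 (Cvec s psi) * T))%:C%C
     - 'i%C * (cos (Arg (Cvec s psi)))%:C%C
            * (sin (norm2 (Cvec s psi) * T))%:C%C).
Proof.
set r := norm2 _; set k := cos (Arg _).
have r2 : r ^+ 2 = (s / 2) ^+ 2 - s * cos psi + 1.
  by rewrite sqr_norm2 /= sin2cos2; field.
have rk : r * k = cos psi - s / 2 by rewrite norm2_cos_Arg /= addrC.
have timeE : T / 2 - - (T / 2) = T by field.
split=> [[gamma [geo ang <- <-]]|q01].
  by rewrite (hdot_geodesic geo ang r2 rk) timeE.
have /hnorm1P q00 := hq0; have /hnorm1P q11 := hq1.
pose b := expi (- (s / 2 * T)) *: q1.
have bb : hdot b b = 1.
  by rewrite hdotZl hdotZr conj_expi opprK q11 mulr1 expiNK.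
have q0b : hdot q0 b = (cos (r * T))%:C%C - 'i%C * k%:C%C * (sin (r * T))%:C%C.
  by rewrite hdotZr conj_expi opprK q01 mulrA [expi _ * _]mulrC expiNK mul1r.
have k1 : -1 <= k <= 1 by rewrite cos_geN1 cos_le1.
have [u [uu q0u bE]] :=
  @unit_circle_through R n.+1 q0 b (r * T) k hn q00 bb k1 q0b.
have [gamma [geo ang gammaE]] :=
  geodesic_great_circle (- (T / 2)) hpsi r2 rk q00 uu q0u.
exists gamma; split=> //; rewrite gammaE.
  by rewrite subrr !mulr0 cos0 sin0 expi0 !scale1r scale0r addr0.
by rewrite timeE -bE /b scalerA mulrC expiNK scale1r.
Qed.
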